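(* The generating function $F_{312}(x,1,z)=\sum_{n\ge0}\sum_{\pi\in\mathfrak{S}_n(312)}x^{\mathrm{fp}(\pi)}z^n$ is given by the continued fraction $$F_{312}(x,1,z)=\cfrac{1}{1-C_0(x-1)z-\cfrac{z}{1-C_1(x-1)z^2-\cfrac{z}{1-C_2(x-1)z^3-\cfrac{z}{1-C_3(x-1)z^4-\cfrac{z}{\ddots}}}}},$$ i.e. at the $n$-th level ($n\ge0$) the term is $C_n(x-1)z^{n+1}$, where $C_n$ is the $n$-th Catalan number (so $C_0=C_1=1$, $C_2=2$, $C_3=5$).
   Context: For permutations $\pi=\pi_1\cdots\pi_n\in\mathfrak{S}_n$ and $\sigma\in\mathfrak{S}_m$, $\pi$ contains $\sigma$ if there are indices $i_1<\dots<i_m$ such that $\pi_{i_1}\cdots\pi_{i_m}$ is in the same relative order as $\sigma$; otherwise $\pi$ avoids $\sigma$. $\mathfrak{S}_n(312)$ is the set of $312$-avoiding permutations in $\mathfrak{S}_n$ ($\mathfrak{S}_0$ contains only the empty permutation). $\mathrm{fp}(\pi)=|\{i:\pi_i=i\}|$. $C_n=\frac{1}{n+1}\binom{2n}{n}$. *)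

(* Defs.v *)
From HB Require Import structures.
From mathcomp Require Import all_boot all_order all_fingroup all_algebra.
From mathcomp Require Import boolp.
Set Implicit Arguments.
Unset Strict Implicit.
Unset Printing Implicit Defensive.
Import GRing.Theory.
Local Open Scope ring_scope.

Definition contains (n m : nat) (p : 'S_n) (s : 'S_m) : bool :=
  [exists f : {ffun 'I_m -> 'I_n},
    [forall i : 'I_m, forall j : 'I_m,
      ((i < j)%N ==> (f i < f j)%N) &&
      ((p (f i) < p (f j))%N == (s i < s j)%N)]].

Definition avoids (n m : nat) (p : 'S_n) (s : 'S_m) : bool := ~~ contains p s.

(* Permutations act on {0, ..., n-1}, so 312 is written 2 0 1. *)
Definition word312 (i : 'I_3) : 'I_3 := inord (nth 0%N [:: 2; 0; 1]%N i).

Lemma word312_inj : injective word312.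
Proof.
move=> [[|[|[|//]]] ?] [[|[|[|//]]] ?] /(congr1 val);
  by rewrite /= !inordK //= => _; apply: val_inj.
Qed.

Definition perm312 : 'S_3 := perm word312_inj.

Definition fp (n : nat) (p : 'S_n) : nat := #|[set i | p i == i]|.

Definition catalan (n : nat) : nat := 'C(n.*2, n) %/ n.+1.

Lemma catalan_exact n : (n.+1 %| 'C(n.*2, n))%N.
Proof.
have -> : 'C(n.*2, n) = (n.+1 * ('C(n.*2, n) - 'C(n.*2, n.+1)))%N.
  by rewrite mulnBr mul_bin_left -addnn addnK mulSn addnK.
exact: dvdn_mulr.
Qed.

Record fps (R : Type) := FPS { fcoef : nat -> R }.

Lemma fpsP (R : Type) (f g : fps R) : fcoef f =1 fcoef g -> f = g.
Proof. by case: f g => [f] [g] /funext /= ->. Qed.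

HB.instance Definition _ (R : Type) := gen_eqMixin (fps R).
HB.instance Definition _ (R : Type) := gen_choiceMixin (fps R).

Section FpsRing.
Variable R : comUnitRingType.
Implicit Types f g h : fps R.

Definition fps_zero : fps R := FPS (fun=> 0).
Definition fps_opp f : fps R := FPS (fun n => - fcoef f n).
Definition fps_add f g : fps R := FPS (fun n => fcoef f n + fcoef g n).

Lemma fps_addA : associative fps_add.
Proof. by move=> f g h; apply: fpsP => n; apply: addrA. Qed.
Lemma fps_addC : commutative fps_add.
Proof. by move=> f g; apply: fpsP => n; apply: addrC. Qed.
Lemma fps_add0 : left_id fps_zero fps_add.
Proof. by move=> f; apply: fpsP => n; apply: add0r. Qed.
Lemma fps_addN : left_inverse fps_zero fps_opp fps_add.
Proof. by move=> f; apply: fpsP => n; apply: addNr. Qed.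

HB.instance Definition _ :=
  GRing.isZmodule.Build (fps R) fps_addA fps_addC fps_add0 fps_addN.

Definition fpsC (c : R) : fps R := FPS (fun n => if n == 0%N then c else 0).
Definition fpsX : fps R := FPS (fun n => (n == 1%N)%:R).
Definition fps_mul f g : fps R :=
  FPS (fun n => \sum_(i < n.+1) fcoef f i * fcoef g (n - i)).

Definition fps_trunc N f : {poly R} := \poly_(i < N) fcoef f i.

Lemma fps_mul_trunc N f g n : (n < N)%N ->
  fcoef (fps_mul f g) n = (fps_trunc N f * fps_trunc N g)`_n.
Proof.
move=> nN; rewrite coefM; apply: eq_bigr => i _.
rewrite !coef_poly (leq_ltn_trans _ nN) ?leq_ord //.
by rewrite (leq_ltn_trans (leq_subr _ _) nN).
Qed.

Lemma fps_mulC : commutative fps_mul.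
Proof. by move=> f g; apply: fpsP => n; rewrite !(@fps_mul_trunc n.+1) // mulrC. Qed.

Lemma fps_mulA : associative fps_mul.
Proof.
move=> f g h; apply: fpsP => n.
set F := fps_trunc n.+1 f; set G := fps_trunc n.+1 g; set H := fps_trunc n.+1 h.
have -> : fcoef (fps_mul f (fps_mul g h)) n = (F * (G * H))`_n.
  rewrite coefM; apply: eq_bigr => i _.
  rewrite (@fps_mul_trunc n.+1 g h) ?ltnS ?leq_subr //.
  by rewrite coef_poly ltn_ord.
have -> : fcoef (fps_mul (fps_mul f g) h) n = (F * G * H)`_n.
  rewrite coefM; apply: eq_bigr => i _.
  rewrite (@fps_mul_trunc n.+1 f g) ?ltn_ord //.
  by rewrite [H`__]coef_poly ltnS leq_subr.
by rewrite mulrA.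
Qed.

Lemma fps_mul1 : left_id (fpsC 1) fps_mul.
Proof.
move=> f; apply: fpsP => n /=.
by rewrite big_ord_recl /= subn0 mul1r big1 ?addr0 // => i _; rewrite mul0r.
Qed.

Lemma fps_mulD : left_distributive fps_mul fps_add.
Proof.
move=> f g h; apply: fpsP => n /=; rewrite -big_split /=.
by apply: eq_bigr => i _; rewrite mulrDl.
Qed.

Lemma fps_oner_neq0 : fpsC 1 != 0.
Proof.
by apply/eqP => /(congr1 (fun f => fcoef f 0%N)) /= /eqP; rewrite oner_eq0.
Qed.

HB.instance Definition _ :=
  GRing.Zmodule_isComNzRing.Build (fps R)
    fps_mulA fps_mulC fps_mul1 fps_mulD fps_oner_neq0.

(* The first n coefficients of f^-1, from f_0 g_n + ... + f_n g_0 = [n = 0]. *)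
Fixpoint fps_inv_seq f n : seq R :=
  if n is m.+1 then
    let s := fps_inv_seq f m in
    rcons s ((fcoef f 0)^-1 * ((m == 0%N)%:R - \sum_(i < m) fcoef f (m - i) * s`_i))
  else [::].

Definition fps_unit : {pred fps R} := [pred f | fcoef f 0 \is a GRing.unit].

Definition fps_inv f : fps R :=
  if fps_unit f then FPS (fun n => (fps_inv_seq f n.+1)`_n) else f.

Lemma size_fps_inv_seq f n : size (fps_inv_seq f n) = n.
Proof. by elim: n => //= n IHn; rewrite size_rcons IHn. Qed.

Lemma nth_fps_inv_seq f n m : (n < m)%N ->
  (fps_inv_seq f m)`_n = (fps_inv_seq f n.+1)`_n.
Proof.
elim: m => // m IHm; rewrite ltnS leq_eqVlt => /predU1P[-> // | nm].
by rewrite -IHm //= nth_rcons size_fps_inv_seq nm.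
Qed.

Lemma fps_mulV : {in fps_unit, left_inverse 1 fps_inv *%R}.
Proof.
move=> f fU; rewrite /fps_inv ifT //; apply: fpsP => n.
have f0U : fcoef f 0 \is a GRing.unit := fU.
rewrite [LHS]big_ord_recr /= subnn nth_rcons size_fps_inv_seq ltnn eqxx.
rewrite [X in _ + X]mulrC mulVKr // addrC.
rewrite [X in _ - _ + X](_ : _ = \sum_(i < n) fcoef f (n - i) * (fps_inv_seq f n)`_i).
  by rewrite subrK; case: n.
apply: eq_bigr => i _; rewrite mulrC; congr (_ * _).
by rewrite [RHS]nth_fps_inv_seq.
Qed.

Lemma fps_unitP f g : g * f = 1 -> fps_unit f.
Proof.
move=> /(congr1 (fun h => fcoef h 0%N)); rewrite [LHS]big_ord1 /= => gf1.
by apply/unitrPr; exists (fcoef g 0); rewrite mulrC.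
Qed.

Lemma fps_inv_out : {in [predC fps_unit], fps_inv =1 id}.
Proof. by move=> f /negbTE fU; rewrite /fps_inv [fps_unit f]fU. Qed.

HB.instance Definition _ :=
  GRing.ComNzRing_hasMulInverse.Build (fps R) fps_mulV fps_unitP fps_inv_out.

(* Convergence in the fpsX-adic topology. *)
Definition fps_cvg (u : nat -> fps R) (f : fps R) : Prop :=
  forall n, exists N0, forall N, (N0 <= N)%N -> fcoef (u N) n = fcoef f n.

End FpsRing.

(* a_k / (b_k - a_{k+1} / (b_{k+1} - ... - a_{k+N} / b_{k+N})) *)
Fixpoint cfrac_from (R : unitRingType) (a b : nat -> R) (N k : nat) : R :=
  a k / (b k - (if N is M.+1 then cfrac_from a b M k.+1 else 0)).

Definition convergent (R : unitRingType) (a b : nat -> R) (N : nat) : R :=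
  cfrac_from a b N 0.

(* [f = a_0 / (b_0 - a_1 / (b_1 - ...))]. Since [/] is total, all denominators
   occurring in the convergents are required to be invertible. *)
Definition is_cfrac (R : comUnitRingType) (a b : nat -> fps R) (f : fps R) : Prop :=
  (forall N k, b k - (if N is M.+1 then cfrac_from a b M k.+1 else 0)
                 \is a GRing.unit) /\
  fps_cvg (convergent a b) f.

(* Series in z over Z[x], with x = 'X and z = fpsX. *)
Definition F312 : fps {poly int} :=
  FPS (fun n => \sum_(p : 'S_n | avoids p perm312) 'X^(fp p)).

(* Main.v *)
(* Cutting a 312-avoiding word at its least letter 0 gives (u+1) 0 (v+k+1) with
   u, v 312-avoiding and k = |u|, because a letter before the 0 cannot exceed one
   after it. In this decomposition the positions j with w_j + d = j are those of
   v for the same d, those of u for d+1, and the position of 0 itself if k = d.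
   Hence the series G_d of x^#{j : w_j + d = j} satisfy
     G_d = 1 + z G_d (G_{d+1} + C_d (x-1) z^d),
   the correction term being C_d (x-1) z^d since the statistic of index d+1
   vanishes on words of length d. That is
   G_d = 1 / (1 - C_d (x-1) z^{d+1} - z G_{d+1}), and F_312 = G_0. *)
Require Import Defs.
From mathcomp Require Import all_boot all_order all_fingroup all_algebra.
From mathcomp Require Import zify ring.
Import GRing.Theory.
Local Open Scope ring_scope.

Set Implicit Arguments.
Unset Strict Implicit.

(** * Words avoiding 312 *)

Fixpoint av312 (w : seq nat) : bool :=
  if w is x :: w' then pairwise (fun y z => ~~ ((y < z) && (z < x))%N) w' && av312 w'
  else true.

Lemma av312P (w : seq nat) :
  reflect (forall i j k, (i < j)%N -> (j < k)%N -> (k < size w)%N ->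
             ~~ ((nth 0%N w j < nth 0%N w k) && (nth 0%N w k < nth 0%N w i))%N)
          (av312 w).
Proof.
elim: w => [|x w IHw] /=; first by apply: ReflectT.
apply: (iffP andP) => [[/(pairwiseP 0%N) xw /IHw ww] [|i] [|j] [|k] //= ij jk kw|H].
- by apply: xw => //; rewrite inE; lia.
- exact: ww.
split.
  apply/(pairwiseP 0%N) => i j; rewrite !inE => iw jw ij.
  exact: (H 0%N i.+1 j.+1).
by apply/IHw => i j k ij jk kw; apply: (H i.+1 j.+1 k.+1).
Qed.

Lemma av312_map (f : nat -> nat) (w : seq nat) :
  {mono f : x y / (x < y)%N} -> av312 (map f w) = av312 w.
Proof.
move=> fmono; elim: w => //= x w ->; congr (_ && _).
by rewrite pairwise_map; apply: eq_pairwise => y z /=; rewrite !fmono.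
Qed.

(** An occurrence of 312 cannot straddle the 0: as 3 or 2 the letter 0 would need a smaller letter,
    and a 3 in [u] with its 2 in [v] would contradict the hypothesis. *)
Lemma av312_cat0 (u v : seq nat) :
  (forall x y, x \in u -> y \in v -> (x < y)%N) ->
  av312 (u ++ 0%N :: v) = av312 u && av312 v.
Proof.
elim: u => [|x u IHu] uv /=.
  rewrite andbC andb_idr // => _; apply/(pairwiseP 0%N) => i j _ _ _.
  by rewrite ltn0 andbF.
rewrite IHu => [|y z yu zv]; last by apply: uv; rewrite ?inE ?yu ?orbT.
rewrite -andbA; congr (_ && _).
have xv z : z \in v -> (x < z)%N by apply: uv; rewrite inE eqxx.
rewrite pairwise_cat andbCA andb_idr //= => _.
apply/andP; split.
  apply/allrelP => y z _; rewrite inE => /predU1P[-> | /xv]; lia.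
apply/andP; split; first by apply/allP => z /xv; lia.
apply/(pairwiseP 0%N) => i j _ jv _; rewrite negb_and -!leqNgt orbC.
by rewrite ltnW // xv // mem_nth.
Qed.

(** Otherwise [x], the 0 and [y] would form a 312. *)
Lemma av312_cat0_le (u v : seq nat) x y :
  av312 (u ++ 0%N :: v) -> x \in u -> y \in v -> (0 < y)%N -> (x <= y)%N.
Proof.
elim: u => //= a u IHu /andP[pa ua]; rewrite inE => /predU1P[-> | xu] yv y0;
  last exact: IHu.
move: pa; rewrite pairwise_cat /= => /and3P[_ _ /andP[/allP /(_ _ yv)]].
by rewrite y0 /= -leqNgt.
Qed.

(** * Cutting a 312-avoiding word at its least letter *)

Definition words312 n : seq (seq nat) :=
  [seq w <- permutations (iota 0 n) | av312 w].

Lemma mem_words312 n w : (w \in words312 n) = av312 w && perm_eq w (iota 0 n).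
Proof. by rewrite mem_filter mem_permutations. Qed.

Lemma words312_uniq n : uniq (words312 n).
Proof. exact/filter_uniq/permutations_uniq. Qed.

Lemma size_words312 n w : w \in words312 n -> size w = n.
Proof. by rewrite mem_words312 => /andP[_ /perm_size]; rewrite size_iota. Qed.

Definition glue312 (u v : seq nat) : seq nat :=
  map (addn 1) u ++ 0%N :: map (addn (size u).+1) v.

(** The shifted copy of [u] contains no 0, so the position of the 0 recovers [size u], hence the cut
    and both shifts. *)
Lemma glue312_inj u v u' v' :
  glue312 u v = glue312 u' v' -> u = u' /\ v = v'.
Proof.
move=> e.
have ind s t : index 0%N (glue312 s t) = size s.
  rewrite index_cat ifF /= ?addn0 ?size_map //.
  by apply/negbTE/mapP => -[].
have sz : size u = size u' by rewrite -(ind u v) e ind.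
move/eqP: e; rewrite /glue312 eqseq_cat ?size_map // eqseq_cons /= sz.
by case/andP => /eqP/inj_map-> => [|x y /addnI //] /eqP/inj_map-> // x y /addnI.
Qed.

(* Sorting [u] and [v] separately sorts [u ++ v], hence yields [iota m n]. *)
Lemma perm_cat_iota u v m n :
  perm_eq (u ++ v) (iota m n) ->
  (forall x y, x \in u -> y \in v -> (x <= y)%N) ->
  perm_eq u (iota m (size u)) /\ perm_eq v (iota (m + size u) (n - size u)).
Proof.
move=> puv uv.
have szuv : (size u + size v = n)%N by rewrite -size_cat (perm_size puv) size_iota.
have : sort leq u ++ sort leq v = iota m n.
  apply: (sorted_eq leq_trans anti_leq); last 2 first.
  - exact: iota_sorted.
  - by apply: perm_trans puv; apply: perm_cat; rewrite perm_sort.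
  rewrite sorted_pairwise; last exact: leq_trans.
  rewrite pairwise_cat -!sorted_pairwise; try exact: leq_trans.
  rewrite !sort_sorted ?andbT; try exact: leq_total.
  by apply/allrelP => x y; rewrite !mem_sort; apply: uv.
rewrite -{1}szuv iotaD => /eqP; rewrite eqseq_cat ?size_sort ?size_iota //.
case/andP => /eqP eu /eqP ev; split; first by rewrite -eu perm_sym perm_sort.
by rewrite -szuv addKn -ev perm_sym perm_sort.
Qed.

(** All letters are at least [m], so truncated subtraction loses nothing. *)
Lemma map_addn_subn m n w :
  perm_eq w (iota m n) -> map (addn m) (map (subn^~ m) w) = w.
Proof.
move=> pw; rewrite -map_comp map_id_in // => x.
by rewrite (perm_mem pw) mem_iota => /andP[mx _] /=; rewrite subnKC.
Qed.

Lemma perm_map_subn m n w :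
  perm_eq w (iota m n) -> perm_eq (map (subn^~ m) w) (iota 0 n).
Proof.
move=> pw; apply: (perm_map_inj (@addnI m)); rewrite (map_addn_subn pw).
by rewrite -iotaDl addn0.
Qed.

Lemma av312_map_addn m w : av312 (map (addn m) w) = av312 w.
Proof. by apply: av312_map => x y; rewrite ltn_add2l. Qed.

Lemma words312S n :
  perm_eq (words312 n.+1)
    [seq glue312 uv.1 uv.2 | k <- iota 0 n.+1,
       uv <- [seq (u, v) | u <- words312 k, v <- words312 (n - k)]].
Proof.
(* Both lists are free of duplicates, so it suffices that they have the same members. *)
apply: uniq_perm; first exact: words312_uniq.
  apply: allpairs_uniq_dep; first exact: iota_uniq.
    by move=> k _; apply: allpairs_uniq; rewrite ?words312_uniq // => -[? ?] [].
  (* The index [k] is determined by the pair, being the length of [u]. *)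
  move=> t t' /allpairsPdep[k [_ [_ /allpairsP[[u v] [uk _ ->]] ->]]].
  move=> /allpairsPdep[k' [_ [_ /allpairsP[[u' v'] [uk' _ ->]] ->]]] /=.
  case/glue312_inj => eu ev; subst.
  by rewrite -(size_words312 uk) -(size_words312 uk').
move=> w; apply/idP/allpairsPdep => [|[k [_ [kn /allpairsP[[u v] [uk vk ->]] ->]]]].
  rewrite mem_words312 => /andP[avw pw].
  have w0 : 0%N \in w by rewrite (perm_mem pw) mem_iota.
  case/splitPr: w0 avw pw => u v avw pw.
  have puv : perm_eq (u ++ v) (iota 1 n).
    by rewrite -(perm_cons 0%N); move: pw; rewrite -cat1s perm_catCA.
  have v0 y : y \in v -> (0 < y)%N.
    by move=> yv; have := perm_mem puv y; rewrite mem_cat yv orbT mem_iota => /esym/andP[].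
  (* Avoidance puts the letters of [u] below those of [v]; hence [u] uses exactly 1, ..., [size u]
     and [v] the remaining letters. *)
  have [pu pv] := perm_cat_iota puv
    (fun x y xu yv => av312_cat0_le avw xu yv (v0 y yv)).
  have szu : (size u <= n)%N.
    by rewrite -(size_iota 1 n) -(perm_size puv) size_cat leq_addr.
  exists (size u), (map (subn^~ 1%N) u, map (subn^~ (size u).+1) v).
  rewrite mem_iota add0n ltnS szu; split => //; last first.
    by rewrite /glue312 (map_addn_subn pu) size_map (map_addn_subn pv).
  have: av312 (u ++ 0%N :: v) := avw.
  rewrite av312_cat0 => [|x y xu yv]; last first.
    move: xu yv; rewrite (perm_mem pu) (perm_mem pv) !mem_iota; lia.
  rewrite -{1}(map_addn_subn pu) -{1}(map_addn_subn pv).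
  rewrite !av312_map_addn.
  case/andP => au av.
  by apply/allpairsP; exists (map (subn^~ 1%N) u, map (subn^~ (size u).+1) v);
     rewrite /= !mem_words312 au av /= (perm_map_subn pu) (perm_map_subn pv).
move: kn; rewrite mem_iota add0n ltnS => /= kn.
have szu := size_words312 uk.
move: uk vk; rewrite !mem_words312 => /andP[au pu] /andP[av pv].
rewrite av312_cat0 => [|_ _ /mapP[x xu ->] /mapP[y _ ->]]; last first.
  by move: xu; rewrite (perm_mem pu) mem_iota szu; lia.
rewrite !av312_map_addn au av /=.
rewrite /glue312 -cat1s perm_catCA /= perm_cons.
rewrite -{1}(subnKC kn) iotaD; apply: perm_cat.
  by rewrite -[1%N]addn0 iotaDl addn0 perm_map.
by rewrite szu add1n -[k.+1]addn0 iotaDl addn0 perm_map.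
Qed.

Lemma big_words312S (V : nmodType) (F : seq nat -> V) n :
  \sum_(w <- words312 n.+1) F w =
  \sum_(k < n.+1) \sum_(u <- words312 k) \sum_(v <- words312 (n - k))
    F (glue312 u v).
Proof.
rewrite (perm_big _ (words312S n)) big_allpairs_dep.
rewrite -[X in iota _ X]subn0 -/(index_iota _ _) big_mkord.
by apply: eq_bigr => k _; rewrite big_allpairs_dep.
Qed.

(** * Shifted fixed points *)

(* [sfp 0 d w] is the number of positions [j] with [w_j + d = j]; the argument
   [i] is the position assigned to the head of [w]. *)
Fixpoint sfp (i d : nat) (w : seq nat) : nat :=
  if w is x :: w' then ((x + d == i)%N + sfp i.+1 d w')%N else 0%N.

Lemma sfp_cat i d u v : sfp i d (u ++ v) = (sfp i d u + sfp (i + size u) d v)%N.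
Proof.
elim: u i => [|x u IHu] i /=; first by rewrite addn0.
by rewrite IHu addSnnS addnA.
Qed.

Lemma sfp_map_addn m i d w : sfp (m + i) d (map (addn m) w) = sfp i d w.
Proof.
elim: w i => //= x w IHw i.
by rewrite -addnS IHw -addnA eqn_add2l.
Qed.

Lemma sfp_map_add1 i d w : sfp i d (map (addn 1) w) = sfp i d.+1 w.
Proof. by elim: w i => //= x w IHw i; rewrite IHw add1n addSnnS. Qed.

Lemma sfp_eq0 i d w : (i + size w <= d)%N -> sfp i d w = 0%N.
Proof.
elim: w i => //= x w IHw i iwd; rewrite IHw ?addSnnS // addn0.
by apply/eqP; rewrite eqb0; lia.
Qed.

(** On [u] only the values move, by 1, which raises [d] to [d.+1]; the 0 sits at position [size u];
    on [v] values and positions move by the same amount, which cancels. *)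
Lemma sfp_glue312 d u v :
  sfp 0 d (glue312 u v) = (sfp 0 d.+1 u + (size u == d) + sfp 0 d v)%N.
Proof.
have := sfp_map_addn (size u).+1 0 d v; rewrite addn0 => vE.
by rewrite sfp_cat sfp_map_add1 /= size_map !add0n vE addnA eq_sym.
Qed.

Lemma sfpE i d w : sfp i d w = (\sum_(j < size w) (nth 0%N w j + d == i + j))%N.
Proof.
elim: w i => [|x w IHw] i /=; first by rewrite big_ord0.
rewrite big_ord_recl /= addn0 IHw; congr (_ + _)%N.
by apply: eq_bigr => j _; rewrite /bump add1n addSnnS.
Qed.

(** * From permutations to words *)

Definition word n (p : 'S_n) : seq nat := [seq val (p i) | i <- enum 'I_n].

Lemma size_word n (p : 'S_n) : size (word p) = n.
Proof. by rewrite size_map size_enum_ord. Qed.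

Lemma nth_word n (p : 'S_n) (i : 'I_n) : nth 0%N (word p) i = p i.
Proof. by rewrite (nth_map i) ?size_enum_ord // nth_ord_enum. Qed.

Lemma word_inj n : injective (@word n).
Proof.
move=> p q pq; apply/permP => i; apply: val_inj.
by rewrite /= -!nth_word pq.
Qed.

Lemma perm_word n (p : 'S_n) : perm_eq (word p) (iota 0 n).
Proof.
rewrite -val_enum_ord /word (map_comp val p); apply: perm_map.
apply: uniq_perm.
- by rewrite map_inj_uniq ?enum_uniq //; apply: perm_inj.
- exact: enum_uniq.
move=> i; rewrite mem_enum; apply/mapP.
by exists (p^-1%g i); rewrite ?mem_enum ?permKV.
Qed.

Lemma wordP n w : perm_eq w (iota 0 n) -> exists p : 'S_n, w = word p.
Proof.
move=> pw; have szw : size w = n by rewrite (perm_size pw) size_iota.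
have wn (i : 'I_n) : (nth 0%N w i < n)%N.
  have: nth 0%N w i \in iota 0 n by rewrite -(perm_mem pw) mem_nth ?szw.
  by rewrite mem_iota.
have winj : injective (fun i => Ordinal (wn i)).
  move=> i j [] /eqP; rewrite nth_uniq ?szw //; first by move/eqP/val_inj.
  by rewrite (perm_uniq pw) iota_uniq.
exists (perm winj); apply: (@eq_from_nth _ 0%N); rewrite szw ?size_word // => i ni.
by rewrite -[i]/(val (Ordinal ni)) nth_word permE.
Qed.

Lemma av312_word n (p : 'S_n) : av312 (word p) = avoids p perm312.
Proof.
apply/av312P/idP => [H|].
  apply/existsPn => f; apply/negP => /'forall_'forall_andP fP.
  have {}fP i j := fP i j; pose o k : 'I_3 := inord k.
  have pfP i j : (p (f i) < p (f j))%N = (perm312 i < perm312 j)%N.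
    by have [_ /eqP] := fP i j.
  have fle (i j : 'I_3) : (i < j)%N -> (f i < f j)%N.
    by have [/implyP] := fP i j.
  (* The three positions chosen by an occurrence [f] are exactly what [H] forbids. *)
  have := H (f (o 0%N)) (f (o 1%N)) (f (o 2%N)).
  rewrite !nth_word !pfP !permE /word312 size_word !inordK //=.
  by rewrite !fle ?inordK // => /(_ isT isT (ltn_ord _)).
move=> /existsPn av i j k ij jk; rewrite size_word => kn.
have jn := ltn_trans jk kn; have ni := ltn_trans ij jn.
pose f := [ffun l : 'I_3 => nth (Ordinal ni) [:: Ordinal ni; Ordinal jn; Ordinal kn] l].
rewrite -[i]/(val (Ordinal ni)) -[j]/(val (Ordinal jn)) -[k]/(val (Ordinal kn)).
rewrite !nth_word; apply: contra (av f) => /andP[pjk pki].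
apply/'forall_'forall_andP => -[[|[|[|//]]] ?] [[|[|[|//]]] ?];
  rewrite !ffunE /= !permE /word312 !inordK //=; split=> //; lia.
Qed.

Lemma fp_word n (p : 'S_n) : fp p = sfp 0 0 (word p).
Proof.
rewrite sfpE size_word /fp -sum1dep_card big_mkcond.
by apply: eq_bigr => i _; rewrite nth_word addn0 add0n -val_eqE /=; case: eqP.
Qed.

Lemma big_avoids312 (V : nmodType) (F : seq nat -> V) n :
  \sum_(p : 'S_n | avoids p perm312) F (word p) = \sum_(w <- words312 n) F w.
Proof.
rewrite -big_filter -(big_map (@word n) predT).
apply: perm_big; apply: uniq_perm.
- by rewrite map_inj_uniq ?filter_uniq ?index_enum_uniq //; apply: word_inj.
- exact: words312_uniq.
move=> w; rewrite mem_words312; apply/mapP/andP => [[p]|[aw /wordP[p wp]]].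
  by rewrite mem_filter => /andP[ap _] ->; rewrite av312_word perm_word.
by exists p; rewrite // mem_filter -av312_word -wp aw mem_index_enum.
Qed.

(** * Power series and the Catalan recurrence *)

Section FpsTheory.
Variable R : comUnitRingType.
Implicit Types f g h : fps R.
Local Notation z := (fpsX R).

Lemma fcoefM f g n : fcoef (f * g) n = \sum_(i < n.+1) fcoef f i * fcoef g (n - i).
Proof. by []. Qed.

Lemma fcoefD f g n : fcoef (f + g) n = fcoef f n + fcoef g n.
Proof. by []. Qed.

Lemma fcoefN f n : fcoef (- f) n = - fcoef f n.
Proof. by []. Qed.

Lemma fcoef1 n : fcoef (1 : fps R) n = (n == 0%N)%:R.
Proof. by case: n. Qed.

Lemma fcoefXM f n : fcoef (z * f) n = if n is m.+1 then fcoef f m else 0.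
Proof.
rewrite fcoefM big_ord_recl mul0r add0r.
case: n => [|n]; first by rewrite big_ord0.
by rewrite big_ord_recl big1 ?addr0 ?mul1r ?subSS ?subn0 // => i _; rewrite mul0r.
Qed.

Lemma fcoefXnM f k n :
  fcoef (z ^+ k * f) n = if (n < k)%N then 0 else fcoef f (n - k).
Proof.
elim: k n => [|k IHk] n; first by rewrite mul1r subn0.
by rewrite exprS -mulrA fcoefXM; case: n => // n; rewrite IHk ltnS subSS.
Qed.

Lemma fcoefCM (c : R) f n : fcoef (fpsC c * f) n = c * fcoef f n.
Proof.
by rewrite fcoefM big_ord_recl big1 ?addr0 ?subn0 // => i _; rewrite mul0r.
Qed.

Lemma unit_fps f : (f \is a GRing.unit) = (fcoef f 0 \is a GRing.unit).
Proof. by []. Qed.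

(** The derivation z d/dz; the factor z keeps the coefficient index unshifted. *)
Definition euler f : fps R := FPS (fun n => fcoef f n *+ n).

Lemma eulerM f g : euler (f * g) = euler f * g + f * euler g.
Proof.
apply: fpsP => n; rewrite fcoefD !fcoefM /= -sumrMnl -big_split /=.
apply: eq_bigr => i _; rewrite mulrnAl mulrnAr -mulrnDr.
by rewrite subnKC // -ltnS ltn_ord.
Qed.

(* With [t = z c'], the equation [c = 1 + z c^2] gives [t (1 - 2 z c) = z c^2],
   and [(1 - 2 z c)^2 = 1 - 4 z]. *)
Lemma euler_catalan (c : fps R) : c = 1 + z * c * c ->
  (1 - 4 * z) * euler c = 1 - c + 2 * z * c.
Proof.
move=> cE.
have tE : euler c = z * c * c + 2 * z * c * euler c.
  have euler1 : euler 1 = 0.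
    by apply: fpsP => -[|n]; rewrite /= ?mulr0n ?mul0rn.
  have eulerX : euler z = z.
    by apply: fpsP => -[|[|n]] //=; rewrite mul0rn.
  have eulerD f g : euler (f + g) = euler f + euler g.
    by apply: fpsP => n; rewrite /= mulrnDl.
  rewrite {1}cE eulerD !eulerM euler1 eulerX; ring.
have zccE : z * c * c = c - 1 by rewrite {3}cE; ring.
have -> : 1 - 4 * z = (1 - 2 * z * c) * (1 - 2 * z * c) :> fps R.
  transitivity (1 - 4 * z * c + 4 * z * (z * c * c)); last by ring.
  by rewrite zccE; ring.
rewrite -mulrA [X in _ * X](_ : _ = z * c * c); last first.
  by rewrite mulrBl mul1r {1}tE; ring.
transitivity (z * c * c - 2 * z * c * (z * c * c)); first by ring.
by rewrite zccE; ring: zccE.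
Qed.
End FpsTheory.

(** The convolution says c = 1 + z c^2 for the generating function c. Comparing coefficients in
    [euler_catalan] yields a first-order recurrence, which the central binomial coefficients divided
    by [n.+1] also satisfy. *)
Lemma catalan_unique (a : nat -> nat) :
  a 0%N = 1%N ->
  (forall n, a n.+1 = (\sum_(k < n.+1) a k * a (n - k))%N) ->
  a =1 catalan.
Proof.
move=> a0 aS.
pose c : fps int := FPS (fun n => (a n)%:R).
have cE : c = 1 + fpsX _ * c * c.
  apply: fpsP => n; rewrite -mulrA fcoefD fcoef1 fcoefXM; case: n => [|n] /=.
    by rewrite a0.
  by rewrite aS add0r natr_sum; apply: eq_bigr => k _; rewrite natrM.
have rec n : (n.+2 * a n.+1 = 2 * n.*2.+1 * a n)%N.
  have /(congr1 (fun f => fcoef f n.+1)) := euler_catalan cE.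
  (* Numerals become constant series so that [fcoefCM] can extract coefficients. *)
  have numE m : m%:R = fpsC m%:R :> fps int.
    elim: m => [|m IHm]; first by apply: fpsP => -[].
    by rewrite -natr1 IHm; apply: fpsP => -[|k] /=; rewrite ?addr0 ?natr1.
  rewrite mulrBl mul1r -!mulrA !(numE _) !fcoefD !fcoefN !fcoefCM !fcoefXM fcoef1 /=.
  lia.
move=> n; rewrite /catalan.
(* The product form keeps the induction free of integer division. *)
suff -> : 'C(n.*2, n) = (n.+1 * a n)%N by rewrite mulKn.
elim: n => [|n IHn]; first by rewrite a0 bin0.
apply/eqP; rewrite -(eqn_pmul2l (ltn0Sn n)); apply/eqP.
have diag : (n.*2.+2 * 'C(n.*2.+1, n) = n.+1 * 'C(n.+1.*2, n.+1))%N.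
  exact: mul_bin_diag.
have down : (n.*2.+1 * 'C(n.*2, n) = n.+1 * 'C(n.*2.+1, n))%N.
  rewrite -[n.*2]/(n.*2.+1.-1) mul_bin_down; congr (_ * _)%N; lia.
rewrite rec -diag -doubleS -mul2n -mulnA -down IHn; lia.
Qed.

(** Counting the pieces of the cut at 0 gives the Catalan convolution. *)
Lemma card_words312 n : size (words312 n) = catalan n.
Proof.
apply: (@catalan_unique (fun n => size (words312 n))) => {n} // n.
rewrite -[LHS]sum1_size big_words312S; apply: eq_bigr => k _.
by under eq_bigr do rewrite sum1_size; rewrite big_const_seq count_predT iter_addn_0 mulnC.
Qed.

(** * The generating functions G_d and their recursion *)

Definition gen312 d : fps {poly int} :=
  FPS (fun n => \sum_(w <- words312 n) 'X^(sfp 0 d w)).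

Lemma F312E : F312 = gen312 0.
Proof.
apply: fpsP => n /=; rewrite -big_avoids312.
by apply: eq_bigr => p _; rewrite fp_word.
Qed.

(* A word of size [d] has no position [j] with [w_j + d.+1 = j]. *)
Lemma gen312_diag d : fcoef (gen312 d.+1) d = (catalan d)%:R.
Proof.
rewrite -card_words312 -sum1_size natr_sum /= !big_seq.
by apply: eq_bigr => w /size_words312 szw; rewrite sfp_eq0 ?szw.
Qed.

Lemma gen312_rec d :
  gen312 d = 1 + fpsX _ * (gen312 d *
    (gen312 d.+1 + fpsC ((catalan d)%:R * ('X - 1)) * fpsX _ ^+ d)).
Proof.
apply: fpsP => n; rewrite fcoefD fcoef1 fcoefXM; case: n => [|n].
  by rewrite /= big_seq1 expr0 addr0.
(* Commuting the product makes [k], the length of [u], index the factor with G_{d+1}. *)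
rewrite add0r mulrC fcoefM [LHS]big_words312S; apply: eq_bigr => k _.
transitivity (fcoef (gen312 d.+1) k * 'X^(k == d :> nat) * fcoef (gen312 d) (n - k)).
  rewrite /= !mulr_suml big_seq [RHS]big_seq; apply: eq_bigr => u /size_words312 szu.
  rewrite mulr_sumr; apply: eq_bigr => v _.
  by rewrite sfp_glue312 szu !exprD.
(* For [k = d] the coefficient C_d of G_{d+1} is multiplied by x, and C_d x = C_d + C_d (x - 1); for
   other [k] the correction vanishes. *)
congr (_ * _); rewrite fcoefD fcoefCM -[fpsX _ ^+ d]mulr1 fcoefXnM fcoef1.
case: (ltngtP k d) => [kd|kd|->].
- by rewrite mulr1 mulr0 addr0.
- by rewrite subn_eq0 leqNgt kd mulr1 mulr0 addr0.
by rewrite subnn gen312_diag eqxx expr1 mulr1; ring.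
Qed.

(** * Convergence of continued fractions with numerators z *)

Section ContinuedFraction.
Variables (R : comUnitRingType) (b g : nat -> fps R).
Local Notation z := (fpsX R).
Local Notation a := (fun k : nat => if k == 0%N then 1 else z).
Hypothesis b0 : forall k, fcoef (b k) 0 = 1.
Hypothesis bg : forall k, g k * (b k - z * g k.+1) = 1.

Let unit_subXM k f : b k - z * f \is a GRing.unit.
Proof. by rewrite unit_fps fcoefD fcoefN fcoefXM b0 subr0 unitr1. Qed.

Let tail N k : fps R := if N is M.+1 then cfrac_from a b M k.+1 else 0.

(** A tail starts at level [k.+1], whose numerator is z, or is 0. Subtracting it thus leaves the
    constant term 1 of [b k], which makes every denominator invertible. *)
Let tailX N k : exists f, tail N k = z * f.
Proof.
case: N => [|N]; first by exists 0; rewrite mulr0.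
by case: N => [|N]; eexists; rewrite /tail /=; reflexivity.
Qed.

Let unit_tail N k : b k - tail N k \is a GRing.unit.
Proof. by have [f ->] := tailX N k; apply: unit_subXM. Qed.

Let cfrac_fromE N k : cfrac_from a b N k = a k / (b k - tail N k).
Proof. by case: N. Qed.

(* Each level [k > 0] contributes a numerator [z] to the error. *)
Let tail_approx N k : exists h, tail N k - z * g k.+1 = z ^+ N.+1 * h.
Proof.
elim: N k => [|N IHN] k; first by exists (- g k.+1); rewrite sub0r mulrN.
have [h hE] := IHN k.+1.
have u := unit_tail N k.+1; have gu := bg k.+1.
(* With D = [b k.+1 - tail N k.+1], the relation [bg] gives 1/D - [g k.+1] = [g k.+1] ([tail N k.+1]
   - z [g k.+2]) / D. *)
exists ((b k.+1 - tail N k.+1)^-1 * g k.+1 * h).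
apply: (mulrI u); rewrite /tail cfrac_fromE mulrBr mulrCA /= divrr // -/(tail _ _).
rewrite [RHS](_ : _ = (b k.+1 - tail N k.+1) / (b k.+1 - tail N k.+1)
                      * g k.+1 * z * (z ^+ N.+1 * h)); last by rewrite exprS; ring.
by rewrite divrr // -hE mulr1 mul1r -{1}[z]mulr1 -gu; ring.
Qed.

(** The hypothesis [bg] is the infinite unfolding g_k = 1 / (b_k - z g_{k+1}); by [tail_approx],
    cutting it off after [N] levels changes [g 0] only by a multiple of z^(N+1). *)
Lemma is_cfrac_rec : is_cfrac a b (g 0%N).
Proof.
split=> [N k|n]; first exact: unit_tail.
exists n => N nN; rewrite /convergent cfrac_fromE div1r.
have [h hE] := tail_approx N 0; have u := unit_tail N 0.
have -> : (b 0%N - tail N 0)^-1 = g 0%N + z ^+ N.+1 * ((b 0%N - tail N 0)^-1 * g 0%N * h).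
  apply: (mulrI u); rewrite divrr // mulrDr.
  rewrite [X in _ + X](_ : _ = (b 0%N - tail N 0) / (b 0%N - tail N 0)
                               * g 0%N * (z ^+ N.+1 * h)); last by ring.
  by rewrite divrr // mul1r -hE -(bg 0); ring.
by rewrite fcoefD fcoefXnM ltnS nN addr0.
Qed.
End ContinuedFraction.

Theorem theorem3p7 :
  let z : fps {poly int} := fpsX _ in
  is_cfrac
    (fun k : nat => if k == 0%N then 1 else z)
    (fun k : nat => 1 - fpsC ((catalan k)%:R * ('X - 1)) * z ^+ k.+1)
    F312.
Proof.
move=> z; rewrite F312E; apply: is_cfrac_rec => k.
  by rewrite fcoefD fcoefN fcoefCM fcoef1 -[_ ^+ _]mulr1 fcoefXnM mulr0 subr0.
(* Only the isolated [gen312 k] is expanded; its non-constant terms cancel the two subtracted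
   products. *)
by rewrite mulrBr mulrBr mulr1 {1}gen312_rec -/z exprS; ring.
Qed.
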